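(* For every oriented graph $D$, \[ \operatorname{hn}(D) \leq |\operatorname{Ext}(D)| + \frac{2}{3}\,|V(D) \setminus \operatorname{Ext}(D)|. \]
   Context: An oriented graph $D$ is an orientation of a finite simple graph, i.e. a digraph with no loops, no multiple arcs and no pair of opposite arcs. A $(u,v)$-path is a directed path from $u$ to $v$, and a $(u,v)$-geodesic is a $(u,v)$-path with the minimum number of arcs. For $S \subseteq V(D)$ with $|S| \geq 2$, $I(S)$ is the set of all vertices lying on some $(u,v)$-geodesic with $u,v \in S$ (endpoints included); if $|S| \leq 1$ then $I(S) = S$. A set $S$ is convex if $I(S) = S$. The (convex) hull $[S]$ of $S$ is the smallest convex set containing $S$. $S$ is a hull set of $D$ if $[S] = V(D)$, and $\operatorname{hn}(D)$ (the hull number) is the minimum cardinality of a hull set of $D$. For $v \in V(D)$, $N^-(v)$ and $N^+(v)$ are its in- and out-neighbourhoods and $d^-(v), d^+(v)$ their sizes. A vertex $v$ is extreme if it is a transmitter ($d^-(v) = 0$), a receiver ($d^+(v) = 0$), or transitive ($d^-(v) > 0$, $d^+(v) > 0$, and $(u,w) \in A(D)$ for every $u \in N^-(v)$ and $w \in N^+(v)$). $\operatorname{Ext}(D)$ denotes the set of extreme vertices of $D$. *)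

(* Defs.v *)
From mathcomp Require Import all_boot all_order all_algebra.

Set Implicit Arguments.
Unset Strict Implicit.
Unset Printing Implicit Defensive.

Definition oriented (V : finType) (arc : rel V) : Prop :=
  irreflexive arc /\ (forall u v, ~~ (arc u v && arc v u)).

Section OrientedGraph.

Variables (V : finType) (arc : rel V).
Implicit Types (u v w x : V) (p q : seq V) (S C : {set V}).

(* A path is encoded by its first vertex u and the sequence p of the vertices
   that follow it, so its number of arcs is size p. *)
Definition dipath u v p : bool :=
  [&& path arc u p, last u p == v & uniq (u :: p)].

Definition geodesic u v p : bool :=
  dipath u v p &&
  ~~ [exists n : 'I_(size p), exists q : n.-tuple V, dipath u v q].

(* Vertices of a path are distinct, so a path has less than #|V| arcs; this
   makes the existential quantification over paths boolean. *)
Definition on_geodesic u v x : bool :=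
  [exists n : 'I_#|V|, exists p : n.-tuple V,
     geodesic u v p && (x \in u :: p)].

Definition interval S : {set V} :=
  if 2 <= #|S|
  then [set x | [exists u in S, exists v in S, on_geodesic u v x]]
  else S.

Definition convex S : bool := interval S == S.

Definition hull S : {set V} :=
  \bigcap_(C : {set V} | convex C && (S \subset C)) C.

Definition hull_set S : bool := hull S == [set: V].

(* [set: V] is the default candidate of arg min; it is always a hull set. *)
Definition hn : nat :=
  #|[arg min_(S < [set: V] | hull_set S) #|S| ]|.

Definition Nin v : {set V} := [set u | arc u v].
Definition Nout v : {set V} := [set w | arc v w].

Definition transmitter v : bool := #|Nin v| == 0.
Definition receiver v : bool := #|Nout v| == 0.
Definition transitive_vertex v : bool :=
  [&& 0 < #|Nin v|, 0 < #|Nout v| &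
      [forall u in Nin v, forall w in Nout v, arc u w]].

Definition Ext : {set V} :=
  [set v | [|| transmitter v, receiver v | transitive_vertex v]].

Lemma geodesicP u v p :
  reflect (dipath u v p /\ (forall q, dipath u v q -> size p <= size q))
          (geodesic u v p).
Proof.
apply: (iffP andP) => -[pP min_p]; split=> //.
  move=> q qP; rewrite leqNgt; apply: contra min_p => lt_qp.
  by apply/existsP; exists (Ordinal lt_qp); apply/existsP; exists (in_tuple q).
apply/existsP=> -[n /existsP[q /min_p]].
by rewrite size_tuple leqNgt ltn_ord.
Qed.

Lemma on_geodesicP u v x :
  reflect (exists2 p, geodesic u v p & x \in u :: p) (on_geodesic u v x).
Proof.
apply: (iffP existsP) => [[n /existsP[p /andP[? ?]]]|[p pP xp]]; first by exists p.
have lt_pV : size p < #|V|.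
  case/andP: pP => /and3P[_ _ /card_uniqP E] _.
  by rewrite -[_ < _]/(size (u :: p) <= _) -E max_card.
exists (Ordinal lt_pV); apply/existsP; exists (in_tuple p).
by rewrite pP.
Qed.

Lemma sub_interval S : S \subset interval S.
Proof.
rewrite /interval; case: ifP => // _; apply/subsetP=> u uS; rewrite inE.
apply/existsP; exists u; rewrite uS /=; apply/existsP; exists u; rewrite uS /=.
apply/on_geodesicP; exists [::]; last by rewrite inE.
by apply/geodesicP; split=> //; rewrite /dipath /= eqxx.
Qed.

Lemma intervalS S C : S \subset C -> interval S \subset interval C.
Proof.
move=> sSC; rewrite {1}/interval; case: ifP => [S2|_]; last first.
  exact: subset_trans sSC (sub_interval C).
rewrite /interval (leq_trans S2 (subset_leq_card sSC)).
apply/subsetP=> x; rewrite !inE => /exists_inP[u uS /exists_inP[v vS xuv]].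
apply/exists_inP; exists u; first exact: (subsetP sSC).
by apply/exists_inP; exists v; first exact: (subsetP sSC).
Qed.

Lemma convex_setT : convex [set: V].
Proof. by rewrite /convex eqEsubset subsetT sub_interval. Qed.

Lemma sub_hull S : S \subset hull S.
Proof. by apply/bigcapsP=> C /andP[]. Qed.

Lemma hull_convex S : convex (hull S).
Proof.
rewrite /convex eqEsubset sub_interval andbT.
apply/bigcapsP=> C /[dup] CP /andP[/eqP <- _].
by apply: intervalS; apply: bigcap_inf.
Qed.

Lemma hull_min S C : convex C -> S \subset C -> hull S \subset C.
Proof. by move=> cC sSC; apply: bigcap_inf; rewrite cC. Qed.

Lemma hull_setT : hull_set [set: V].
Proof. by rewrite /hull_set eqEsubset subsetT sub_hull. Qed.

Lemma hnP :
  (exists2 S, hull_set S & #|S| = hn) /\ (forall S, hull_set S -> hn <= #|S|).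
Proof.
rewrite /hn; case: arg_minnP => [|S hS min_S]; first exact: hull_setT.
by split=> //; exists S.
Qed.

End OrientedGraph.

(* Main.v *)
(** A non-extreme vertex [v] has an in-neighbour [u] and an out-neighbour [w]
    with no arc from [u] to [w], so [u, v, w] is a geodesic and every convex set
    containing [u] and [w] contains [v]. Hence a set [T] of non-extreme vertices
    can be left out of a hull set as soon as its elements can be recovered one
    after the other. Such a [T] is chosen greedily: put any available
    non-extreme [v] in [T] and discard [v] and its pair [u, w]; each step costs
    at most three vertices, so [T] contains a third of the non-extreme ones. *)

Require Import Defs.
From mathcomp Require Import all_boot all_order all_algebra.
From mathcomp Require Import zify lra.

Local Open Scope ring_scope.

Lemma convex_between (V : finType) (arc : rel V) (C : {set V}) (u v w : V) :
  oriented arc -> convex arc C -> arc u v -> arc v w -> ~~ arc u w ->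
  u \in C -> w \in C -> v \in C.
Proof.
move=> [irr asym] /eqP cC auv avw nauw uC wC.
have neq_arc x y : arc x y -> x != y.
  by move=> axy; apply: contraTneq axy => ->; rewrite irr.
have nuw : u != w.
  by apply: contraTneq avw => <-; have := asym u v; rewrite auv.
have C2 : (2 <= #|C|)%N.
  have <- : #|[set u; w]| = 2%N by rewrite cards2 nuw.
  by apply: subset_leq_card; rewrite subUset !sub1set uC wC.
rewrite -cC /Defs.interval C2 inE.
apply/exists_inP; exists u => //; apply/exists_inP; exists w => //.
apply/on_geodesicP; exists [:: v; w]; last by rewrite !inE eqxx orbT.
apply/geodesicP; split.
  by rewrite /dipath /= auv avw eqxx !inE negb_or nuw !neq_arc.
(* Only paths with fewer than two arcs could be shorter: the empty one would force [u = w], a single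
   arc would be the excluded arc from [u] to [w]. *)
case=> [|x [|y q]] //; rewrite /dipath /=.
  by rewrite (negbTE nuw).
by case/and3P=> /andP[aux _] /eqP ewx _; rewrite -ewx aux in nauw.
Qed.

Lemma non_extreme_witness (V : finType) (arc : rel V) (v : V) :
  v \notin Ext arc -> exists u w, [/\ arc u v, arc v w & ~~ arc u w].
Proof.
rewrite inE /transmitter /receiver /transitive_vertex !negb_or -!lt0n.
case/and3P=> -> -> /=; rewrite negb_forall => /existsP[u].
rewrite negb_imply inE => /andP[auv]; rewrite negb_forall => /existsP[w].
by rewrite negb_imply inE => /andP[avw nauw]; exists u, w.
Qed.

(** [K] stands for convexity. Since [u] and [w] may lie outside [A], the hypothesis passes to
    subsets of [A], which allows induction on [#|A|]. *)
Lemma recoverable_third (V : finType) (K : {set V} -> Prop) (A : {set V}) :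
  (forall v, v \in A -> exists u w, [/\ u != v, w != v &
     forall C, K C -> u \in C -> w \in C -> v \in C]) ->
  exists T : {set V}, [/\ T \subset A, (#|A| <= 3 * #|T|)%N &
     forall C, K C -> ~: T \subset C -> C = [set: V]].
Proof.
have [n leAn] := ubnP #|A|; elim: n A leAn => // n IHn A leAn recA.
have [A0 | [v vA]] := set_0Vmem A.
  exists set0; split; rewrite ?sub0set ?A0 ?cards0 // => C _.
  by rewrite setC0 subTset => /eqP.
have [u [w [nuv nwv recv]]] := recA v vA.
pose B := [set v; u; w]; pose A' := A :\: B.
have vA' : v \notin A' by rewrite !inE eqxx.
have sA'A : A' \subset A by apply: subsetDl.
have ltA' : (#|A'| < n)%N.
  apply: leq_trans (ltnSE leAn); apply: proper_card.
  by apply/properP; split=> //; exists v.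
have [|T [sT leT recT]] := IHn A' ltA'.
  by move=> x /(subsetP sA'A); apply: recA.
have vT : v \notin T by apply: contra vA'; apply: (subsetP sT).
exists (v |: T); split.
- by rewrite subUset sub1set vA (subset_trans sT).
- have leB : (#|B| <= 3)%N.
    by rewrite /B -setUA !cardsU1 cards1; case: (_ \notin _); case: (_ \notin _).
  have := cardsID B A; have := subset_leq_card (subsetIr A B).
  by rewrite cardsU1 vT -/A'; lia.
- move=> C KC sTC; apply: (recT C KC); apply/subsetP=> x; rewrite inE => xT.
  have [-> | nxv] := eqVneq x v; last first.
    by apply: (subsetP sTC); rewrite !inE negb_or nxv.
  (* [T] avoids [B], so [u] and [w] are never left out: [v] is recovered first, then [T] by
     induction. *)
  have outT y : y \in B -> y != v -> y \in C.
    move=> yB nyv; apply: (subsetP sTC); rewrite !inE negb_or nyv /=.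
    by apply/negP=> /(subsetP sT); rewrite inE yB.
  by apply: recv => //; apply: outT; rewrite // !inE eqxx ?orbT.
Qed.

Theorem theorem1 (V : finType) (arc : rel V) (harc : oriented arc) :
  (hn arc)%:R <= #|Ext arc|%:R + 2%:R / 3%:R * #|[set: V] :\: Ext arc|%:R :> rat.
Proof.
have [|T [_ leT recT]] :=
    @recoverable_third V (convex arc) ([set: V] :\: Ext arc).
  move=> v; rewrite inE => /andP[/non_extreme_witness[u [w [auv avw nauw]]] _].
  have irr := harc.1; exists u, w; split.
  - by apply: contraTneq auv => ->; rewrite irr.
  - by apply: contraTneq avw => ->; rewrite irr.
  - by move=> C cC; apply: convex_between harc cC auv avw nauw.
have hT : hull_set arc (~: T).
  by rewrite /hull_set (recT _ (hull_convex _ _) (sub_hull _ _)).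
(* The bound is cleared of its denominator to be proved in [nat], from [hn arc <= #|V| - #|T|]. *)
have le_hn : (3 * hn arc <= 3 * #|Ext arc| + 2 * #|[set: V] :\: Ext arc|)%N.
  have := (hnP arc).2 _ hT; have := cardsC T.
  have := cardsID (Ext arc) [set: V]; rewrite setTI cardsT; lia.
move: le_hn; rewrite -(Num.Theory.ler_nat rat) GRing.natrD !GRing.natrM; lra.
Qed.
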